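(* There exist random probability measures $\mu,\nu$ on $\mathbb{R}$, uniformly bounded and a.s. in $P^+$, such that $\mu$ and $\nu$ do not have the same distribution, but for every $s\ge0$ the random variables $\mathcal{L}_\mu(s)$ and $\mathcal{L}_\nu(s)$ have the same distribution, and for every $s\in\mathbb{R}$ the random variables $\mathcal{M}_\mu(s)$ and $\mathcal{M}_\nu(s)$ have the same distribution.
   Context: $P(\mathbb{R})$ denotes the set of Borel probability measures on $\mathbb{R}$, with the $\sigma$-algebra generated by the maps $\mu\mapsto\mu(B)$, $B\subset\mathbb{R}$ Borel. A random probability measure is a random variable with values in $P(\mathbb{R})$. It is uniformly bounded if there is a (deterministic) $M>0$ such that $\mu$ is a.s. supported in $[-M,M]$. $P^+$ is the set of $\mu\in P(\mathbb{R})$ supported in $[0,\infty)$. $\mathcal{L}_\mu(s)=\int_{[0,\infty)}e^{-sx}\,d\mu(x)$ and $\mathcal{M}_\mu(s)=\int_{\mathbb{R}}e^{sx}\,d\mu(x)$. *)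

(* Defs.v *)
From HB Require Import structures.
From mathcomp Require Import all_boot all_order all_algebra.
From mathcomp Require Import all_classical all_reals all_analysis.
From mathcomp Require Import measurable_realfun.

Set Implicit Arguments.
Unset Strict Implicit.
Unset Printing Implicit Defensive.

Import Order.TTheory GRing.Theory Num.Theory.
Import numFieldNormedType.Exports.

Local Open Scope classical_set_scope.
Local Open Scope ring_scope.
Local Open Scope ereal_scope.

(* [pprobability] carries the sigma-algebra generated by the sets
   [{mu | mu U < r}] for [U] Borel and [0 <= r <= 1], i.e., by the evaluation
   maps [mu |-> mu U]. *)
Notation borel_prob R := (pprobability (measurableTypeR R) R).

Section borel_probability_measures.
Context {R : realType}.
Implicit Types (m : borel_prob R) (A : set R) (s : R).

(* Only used with [A] closed, where it says that the topological support of [m]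
   is contained in [A]. *)
Definition supported_in m A : Prop := m A = 1.

Definition Pplus : set (borel_prob R) :=
  [set m | supported_in m `[0%R, +oo[%classic].

(* The two transforms are extended-real-valued because [mgf s m] may be
   infinite when [m] is not compactly supported. *)
Definition laplace s m : \bar R :=
  \int[m]_(x in `[0%R, +oo[%classic) (expR (- (s * x)))%:E.

Definition mgf s m : \bar R := \int[m]_x (expR (s * x))%:E.

Lemma measurable_eval (A : set (measurableTypeR R)) : measurable A ->
  measurable_fun [set: borel_prob R] (fun m => m A : \bar R).
Proof.
exact: (@measurable_kernel _ _ _ _ _
  (kprobability (@measurable_id _ (borel_prob R) setT))).
Qed.

Let measurable_expRM s :
  measurable_fun [set: measurableTypeR R] (fun x : R => (expR (s * x))%:E).
Proof.
apply/measurable_EFinP; exact: measurableT_comp.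
Qed.

Lemma measurable_laplace s : measurable_fun [set: borel_prob R] (laplace s).
Proof.
rewrite (_ : laplace s = fun m => \int[m]_x
    ((fun x => (expR (- (s * x)))%:E) \_ `[0%R, +oo[%classic) x); last first.
  by apply/funext => m; rewrite /laplace integral_mkcond.
apply: (measurable_fun_integral_kernel measurable_eval).
  by move=> x; rewrite patchE; case: ifPn => // _; rewrite lee_fin expR_ge0.
apply/(measurable_restrictT _ _).1; first exact: measurable_itv.
apply: measurable_funTS; apply: eq_measurable_fun (measurable_expRM (- s)).
by move=> x _; rewrite mulNr.
Qed.

Lemma measurable_mgf s : measurable_fun [set: borel_prob R] (mgf s).
Proof.
apply: (measurable_fun_integral_kernel measurable_eval) => [x|].
  by rewrite lee_fin expR_ge0.
exact: measurable_expRM.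
Qed.

HB.instance Definition _ s :=
  isMeasurableFun.Build _ _ _ _ (laplace s) (measurable_laplace s).

HB.instance Definition _ s :=
  isMeasurableFun.Build _ _ _ _ (mgf s) (measurable_mgf s).

End borel_probability_measures.

Section random_probability_measures.
Context d {Omega : measurableType d} {R : realType} (P : probability Omega R).

Definition random_prob_measure := {RV P >-> borel_prob R}.

Definition laplace_rv (mu : random_prob_measure) (s : R) : {RV P >-> \bar R} :=
  laplace s \o mu.

Definition mgf_rv (mu : random_prob_measure) (s : R) : {RV P >-> \bar R} :=
  mgf s \o mu.

Definition uniformly_bounded (mu : random_prob_measure) : Prop :=
  exists2 M : R, (0 < M)%R &
    \forall w \ae P, supported_in (mu w) `[(- M)%R, M]%classic.

Definition as_in_Pplus (mu : random_prob_measure) : Prop :=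
  \forall w \ae P, Pplus (mu w).

(* Equality of the laws on measurable sets only: [=] between set functions
   would also compare the meaningless values on non-measurable sets. *)
Definition same_distribution d' (T : measurableType d') (X Y : {RV P >-> T}) :
    Prop :=
  forall A, measurable A -> distribution P X A = distribution P Y A.

End random_probability_measures.

(* [random_prob_measure P] and [{RV P >-> T}] unfold to types of measurable
   functions that do not mention [P], so [P] cannot be inferred from them. *)
Arguments laplace_rv {d Omega R} P mu s.
Arguments mgf_rv {d Omega R} P mu s.
Arguments uniformly_bounded {d Omega R} P mu.
Arguments as_in_Pplus {d Omega R} P mu.
Arguments same_distribution {d Omega R} P {d' T} X Y.

(* Main.v *)
(* Both random measures are mixtures
     (1/4) sum_(k < 4) (x_k delta_k + (1 - x_k) delta_(k+1)),
   whose moment generating function at [s] is an affine function of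
   [x_0 + u x_1 + u^2 x_2 + u^3 x_3] with [u = exp s].  The vectors
   [(1, u, u^2, u^3)] lie on the quadric [a d = b c], so it suffices that the two
   laws of [x] differ by a signed measure whose Fourier transform is a multiple
   of [t_0 t_3 - t_1 t_2], e.g. the image of the indicator function of the unit
   cube under the operator [d_0 d_3 - d_1 d_2].  The two terms of that image are
   combinations of uniform laws on two-dimensional faces of the cube: with
   [i, j] fair bits and [U, V] uniform on [0, 1], all independent, one law is
   [(i, U, V, j)] if [i = j] and [(U, i, j, V)] if not, and the other one is
   obtained by exchanging the two cases. *)

Require Import Defs.
From HB Require Import structures.
From mathcomp Require Import all_boot all_order all_algebra.
From mathcomp Require Import all_classical all_reals all_analysis.
From mathcomp Require Import measurable_realfun.
From mathcomp Require Import ring lra.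

Set Implicit Arguments.
Unset Strict Implicit.
Unset Printing Implicit Defensive.

Import Order.TTheory GRing.Theory Num.Theory.
Import numFieldNormedType.Exports.

Local Open Scope classical_set_scope.
Local Open Scope ring_scope.
Local Open Scope ereal_scope.

(** * Averages over segments and their exchange identities *)

Section segment_average.
Context {R : realType}.
Local Notation mu := (@lebesgue_measure R).
Local Notation unif01 := (uniform_prob (@ltr01 R)).
Implicit Types (a b c d r : R) (g : R -> \bar R).

Definition affine a b : measurableTypeR R -> measurableTypeR R :=
  fun x => (b + a * x)%R.

Lemma measurable_affine a b : measurable_fun setT (affine a b).
Proof. by apply: measurable_funD => //; exact: measurable_funM. Qed.

Lemma preimage_affine_itvoc a b (p q : R) : (0 < a)%R ->
  affine a b @^-1` `]p, q]%classic = `]((p - b) / a)%R, ((q - b) / a)%R]%classic.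
Proof.
move=> a0; apply/seteqP; rewrite /affine; split=> x /=; rewrite !in_itv/=.
  by rewrite ltr_pdivrMr// ler_pdivlMr// ltrBlDl lerBrDl mulrC.
by rewrite ltr_pdivrMr// ler_pdivlMr// ltrBlDl lerBrDl mulrC.
Qed.

Definition affine_image a b : set (measurableTypeR R) -> \bar R :=
  pushforward mu (affine a b).

(* The measure instance of [pushforward] is named explicitly because it takes
   the measurability proof, which unification cannot find. *)
HB.instance Definition _ a b := Measure.copy (affine_image a b)
  (measure_function_pushforward__canonical__measure_function_Measure mu
    (@measurable_affine a b)).

(** Lebesgue measure is determined by its values on half-open intervals, whose preimages have
    lengths divided by [a]. *)
Lemma lebesgue_measure_affine a b (a0 : (0 < a)%R) (A : set (measurableTypeR R)) :
  measurable A -> mu A = mscale (NngNum (ltW a0)) (affine_image a b) A.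
Proof.
move=> mA; apply: lebesgue_measure_unique => // _ [[p q]] _ <-.
rewrite -[RHS]/(a%:E * mu (affine a b @^-1` `]p, q]%classic)).
rewrite preimage_affine_itvoc//.
rewrite !lebesgue_measure_itv/= !lte_fin ltr_pM2r ?invr_gt0// ltrD2r.
case: ifPn => _; last by rewrite mule0.
by rewrite -!EFinD -EFinM; congr EFin; field; rewrite gt_eqF.
Qed.

Definition average a g r : \bar R := \int[unif01]_x g (r + a * x)%R.

(** Change of variables. The segment is half-open so that consecutive segments are disjoint and can
    be glued. *)
Lemma segment_integral a r g : (0 < a)%R -> measurable_fun setT g ->
    (forall x, 0 <= g x) ->
  a%:E * average a g r = \int[mu]_(x in `]r, (r + a)%R]) g x.
Proof.
move=> a0 mg g0; pose k := NngNum (ltW a0); rewrite /average.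
rewrite integral_uniform//; last first.
  exact: (measurableT_comp mg (measurable_affine a r)).
rewrite subr0 invr1 mul1e -[a%:E]/k%:num%:E.
rewrite -(@integral_itv_obnd_cbnd _ _ (BRight 1%R))//; last first.
  apply: measurable_funTS; exact: (measurableT_comp mg (measurable_affine a r)).
have -> : `]0%R, 1%R]%classic = affine a r @^-1` `]r, (r + a)%R]%classic.
  by rewrite preimage_affine_itvoc// subrr mul0r addrAC subrr add0r divff ?gt_eqF.
rewrite -(ge0_integral_pushforward (measurable_affine a r))//; last first.
  exact: measurable_funTS.
rewrite -/(affine_image a r).
rewrite -(@ge0_integral_mscale _ _ _ (affine_image a r) _ _ k)//; last first.
  exact: measurable_funTS.
by apply/esym; apply: eq_measure_integral => A mA _; exact: lebesgue_measure_affine.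
Qed.

(** Both sides are the integral of [g] over the segment of length [a + b] starting at [r], cut at
    [r + b] on the left and at [r + a] on the right. *)
Lemma average_swap1 a b r g : (0 < a)%R -> (0 < b)%R ->
    measurable_fun setT g -> (forall x, 0 <= g x) ->
  b%:E * average b g r + a%:E * average a g (r + b)%R =
  a%:E * average a g r + b%:E * average b g (r + a)%R.
Proof.
have cat p q : (0 < p)%R -> (0 < q)%R ->
    measurable_fun setT g -> (forall x, 0 <= g x) ->
    p%:E * average p g r + q%:E * average q g (r + p)%R =
    \int[mu]_(x in `]r, (r + (p + q))%R]) g x.
  move=> p0 q0 mg g0; rewrite !segment_integral//.
  rewrite -ge0_integral_setU//=.
  - rewrite -itv_bndbnd_setU ?addrA// bnd_simp; lra.
  - exact: measurable_funTS.
  - apply/disj_setPS => x [] /=; rewrite !in_itv/=.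
    by move=> /andP[_ ?] /andP[]; rewrite ltNge => /negP.
by move=> a0 b0 mg g0; rewrite !cat// (addrC a).
Qed.

Lemma average_ge0 a g r : (forall x, 0 <= g x) -> 0 <= average a g r.
Proof. by move=> g0; exact: integral_ge0. Qed.

Lemma average_le1 a g r : measurable_fun setT g ->
  (forall x, 0 <= g x <= 1) -> average a g r <= 1.
Proof.
move=> mg g01; apply: (@le_trans _ _ (\int[unif01]_x cst 1 x)).
  apply: ge0_le_integral => //= [x _||x _].
  - by case/andP: (g01 (r + a * x)%R).
  - exact: (measurableT_comp mg (measurable_affine a r)).
  - by case/andP: (g01 (r + a * x)%R).
by rewrite integral_cst// mul1e [leLHS]probability_setT.
Qed.

Lemma measurable_average a g : measurable_fun setT g -> (forall x, 0 <= g x) ->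
  measurable_fun setT (average a g).
Proof.
move=> mg g0.
apply: (@measurable_fun_fubini_tonelli_F _ _ _ _ R unif01
  (fun z : measurableTypeR R * measurableTypeR R => g (z.1 + a * z.2)%R)) => //.
apply: (measurableT_comp mg); apply: measurable_funD => //.
exact: measurable_funM.
Qed.

Lemma averageZ a p g r : (0 <= p)%R -> measurable_fun setT g ->
  (forall x, 0 <= g x) ->
  average a (fun x => p%:E * g x) r = p%:E * average a g r.
Proof.
move=> p0 mg g0; rewrite /average ge0_integralZl//.
exact: (measurableT_comp mg (measurable_affine a r)).
Qed.

Lemma averageD a (f g : R -> \bar R) r :
    measurable_fun setT f -> (forall x, 0 <= f x) ->
    measurable_fun setT g -> (forall x, 0 <= g x) ->
  average a (f \+ g) r = average a f r + average a g r.
Proof.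
move=> mf f0 mg g0; rewrite /average ge0_integralD//.
  exact: (measurableT_comp mf (measurable_affine a r)).
exact: (measurableT_comp mg (measurable_affine a r)).
Qed.

Lemma average_shift a g r t :
  average a g (r + t)%R = average a (fun x => g (x + t)%R) r.
Proof. by apply: eq_integral => x _; rewrite (addrAC r t). Qed.

Lemma eq_average a (f g : R -> \bar R) r :
  f =1 g -> average a f r = average a g r.
Proof. by move=> fg; apply: eq_integral => x _; rewrite fg. Qed.

(** Stated while [average] is transparent, to give access to the double integral later. *)
Lemma average_average a b g r : average a (average b g) r =
  \int[unif01]_x \int[unif01]_y g (r + a * x + b * y)%R.
Proof. by []. Qed.

(* Unification may otherwise unfold [average] down to the definition of the
   Lebesgue integral, with exponential slowdowns. *)
#[local] Opaque average.

(** By linearity and translation each side is a single outer average, and [average_swap1] equates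
    the two integrands pointwise. *)
Lemma average_average_swap a c d r g : (0 < c)%R -> (0 < d)%R ->
    measurable_fun setT g -> (forall x, 0 <= g x) ->
  c%:E * average a (average c g) r + d%:E * average a (average d g) (r + c)%R =
  d%:E * average a (average d g) r + c%:E * average a (average c g) (r + d)%R.
Proof.
move=> c0 d0 mg g0.
have avg0 p x : 0 <= average p g x by exact: average_ge0.
have mavg p := measurable_average p mg g0.
have mavgt p t : measurable_fun setT (fun x : R => average p g (x + t)%R).
  by apply: (measurableT_comp (mavg p)); exact: measurable_funD.
have avgD p q t : (0 < p)%R -> (0 < q)%R ->
    p%:E * average a (average p g) r + q%:E * average a (average q g) (r + t)%R =
    average a ((fun x => p%:E * average p g x) \+
               (fun x => q%:E * average q g (x + t)%R)) r.
  move=> p0 q0; have [p0' q0'] := (ltW p0, ltW q0); rewrite [RHS]averageD.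
  - rewrite average_shift -(averageZ _ _ p0' (mavg p))//.
    by rewrite -(averageZ _ _ q0' (mavgt q t)).
  - exact: measurable_funeM.
  - by move=> x; rewrite mule_ge0.
  - exact: measurable_funeM.
  - by move=> x; rewrite mule_ge0.
rewrite (avgD c d c c0 d0) (avgD d c d d0 c0).
by apply: eq_average => x; exact: average_swap1.
Qed.

(* [b * average b] is convolution with Lebesgue measure on a segment of length
   [b], so that [b * average b \o (1 - shift a)] is symmetric in [a] and [b].
   Applied to the pairs [(a, b)] and [(d, c)], this symmetry identifies
   [average b \o average c \o (1 - shift a) \o (1 - shift d)] with
   [average a \o average d \o (1 - shift b) \o (1 - shift c)]. *)
Lemma average_swap a b c d g :
    (0 < a)%R -> (0 < b)%R -> (0 < c)%R -> (0 < d)%R -> (a * d = b * c)%R ->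
    measurable_fun setT g -> (forall x, 0 <= g x <= 1) ->
  average b (average c g) 0%R + average b (average c g) (a + d)%R +
    (average a (average d g) b + average a (average d g) c) =
  average b (average c g) a + average b (average c g) d +
    (average a (average d g) 0%R + average a (average d g) (b + c)%R).
Proof.
move=> a0 b0 c0 d0 adbc mg g01.
have g0 x : 0 <= g x by case/andP: (g01 x).
have avg0 p x : 0 <= average p g x by exact: average_ge0.
have mavg p := measurable_average p mg g0.
have avgfin p q r : average p (average q g) r \is a fin_num.
  rewrite ge0_fin_numE; last exact: average_ge0.
  apply: le_lt_trans (ltry 1); apply: average_le1 => // x.
  by rewrite avg0/= average_le1.
(* All double averages are finite because [g] is bounded; what remains is real arithmetic. *)
have [I E] : exists I, forall p q r, average p (average q g) r = (I p q r)%:E.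
  by exists (fun p q r => fine (average p (average q g) r)) => p q r; rewrite fineK.
have out r : (b * (c * I b c r) + a * (c * I a c (r + b)) =
    a * (c * I a c r) + b * (c * I b c (r + a)))%R.
  have ch0 x : 0 <= c%:E * average c g x by rewrite mule_ge0// lee_fin ltW.
  have mch := measurable_funeM c%:E (mavg c).
  have avgZ p t := averageZ p t (ltW c0) (mavg c) (avg0 c).
  have := average_swap1 r a0 b0 mch ch0.
  by rewrite (avgZ b r) (avgZ b) (avgZ a r) (avgZ a) !E -!EFinM -!EFinD => -[].
have inn r :
    (c * I a c r + d * I a d (r + c) = d * I a d r + c * I a c (r + d))%R.
  have := average_average_swap a r c0 d0 mg g0.
  by rewrite !E -!EFinM -!EFinD => -[].
rewrite !E -!EFinD; congr EFin.
(* With the weights [b * c = a * d], the mixed terms [I a c] cancel between these four instances. *)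
have := out 0%R; have := out d; have := inn 0%R; have := inn b.
rewrite !add0r (addrC d a) (addrC d b) => i1 i2 o1 o2.
have bc0 : (b * c != 0)%R by rewrite mulf_neq0 ?gt_eqF.
apply: (mulfI bc0).
have {}i1 := congr1 ( *%R a) i1.
have {}i2 := congr1 ( *%R a) i2.
have -> : (b * c * (I b c 0 + I b c (a + d) + (I a d b + I a d c)) =
  b * c * I b c 0 + b * c * I b c (a + d) + (a * d * I a d b + a * d * I a d c))%R.
  by rewrite adbc; ring.
have -> : (b * c * (I b c a + I b c d + (I a d 0 + I a d (b + c))) =
  b * c * I b c a + b * c * I b c d + (a * d * I a d 0 + a * d * I a d (b + c)))%R.
  by rewrite adbc; ring.
lra.
Qed.

End segment_average.

(** * Mixtures over the edges of the path 0, ..., 4 and their transforms *)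

Section edge_mixture.
Context {R : realType}.
Implicit Types (x : nat -> R) (s : R) (f : R -> \bar R).

Definition edge (k : nat) (b : bool) : measurableTypeR R :=
  if b then k%:R else k.+1%:R.

HB.instance Definition _ k := isMeasurableFun.Build _ _ _ _ (edge k)
  (fun _ _ _ => I : measurable (_ : set bool)).

(** Since [bernoulli_prob] is a probability for every real parameter, this is a probability for
    every [x]; the explicit weights [x k] and [1 - x k] are used only when they lie in [0, 1]. *)
Definition edge_mixture x : set (measurableTypeR R) -> \bar R :=
  msum (fun k => mscale ((4^-1)%:nng)%R
    (distribution (bernoulli_prob (x k)) (edge k))) 4.

HB.instance Definition _ x := Measure.on (edge_mixture x).

Lemma edge_mixtureE x (A : set (measurableTypeR R)) : edge_mixture x A =
  \sum_(k < 4) (4^-1)%:E * bernoulli_prob (x k) (edge k @^-1` A).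
Proof. by []. Qed.

Lemma edge_mixture1 x (A : set (measurableTypeR R)) :
  (forall k, (k <= 4)%N -> A k%:R%R) -> edge_mixture x A = 1.
Proof.
move=> Ak; rewrite edge_mixtureE.
under eq_bigr => k _.
  have -> : edge k @^-1` A = setT.
    by apply/seteqP; split => // -[] _; apply: Ak; rewrite // ltnW.
  rewrite probability_setT mule1; over.
by rewrite !big_ord_recr big_ord0/= add0e -!EFinD; congr EFin; field.
Qed.

Let edge_mixtureT x : edge_mixture x setT = 1.
Proof. exact: edge_mixture1. Qed.

HB.instance Definition _ x := Measure_isProbability.Build _ _ _
  (edge_mixture x) (edge_mixtureT x).

(** The sigma-algebra is generated by evaluations at Borel sets, and each evaluation is a finite sum
    of measurable functions of the parameters. *)
Lemma measurable_edge_mixture d (T : measurableType d) (x : T -> nat -> R) :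
  (forall k, measurable_fun setT (x ^~ k)) ->
  measurable_fun setT (fun w => edge_mixture (x w) : borel_prob R).
Proof.
move=> mx; apply: (measurability (@pset _ _ _ : set (set (borel_prob R)))) => //.
move=> _ -[_ [r r01] [A mA <-]] <-; apply: emeasurable_fun_infty_o => //=.
apply: emeasurable_sum => k; apply: measurable_funeM.
exact: (measurableT_comp (measurable_bernoulli_prob2 _) (mx k)).
Qed.

Lemma integral_edge_mixture x f : measurable_fun setT f -> (forall t, 0 <= f t) ->
  \int[edge_mixture x]_t f t =
  \sum_(k < 4) (4^-1)%:E * \int[bernoulli_prob (x k)]_b f (edge k b).
Proof.
move=> mf f0; rewrite ge0_integral_measure_sum//.
apply: eq_bigr => k _; rewrite ge0_integral_mscale//=.
by rewrite ge0_integral_distribution.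
Qed.

Lemma integral_edge_mixture01 x f : measurable_fun setT f ->
    (forall t, 0 <= f t) -> (forall k, (k < 4)%N -> (0 <= x k <= 1)%R) ->
  \int[edge_mixture x]_t f t =
  \sum_(k < 4) (4^-1)%:E * ((x k)%:E * f k%:R%R + (1 - x k)%:E * f k.+1%:R%R).
Proof.
move=> mf f0 x01; rewrite integral_edge_mixture//.
by apply: eq_bigr => k _; rewrite integral_bernoulli_prob// x01.
Qed.

(** All atoms are nonnegative, so restricting the integral to the half-line changes nothing. *)
Lemma laplace_edge_mixture s x :
  laplace s (edge_mixture x : borel_prob R) =
  mgf (- s) (edge_mixture x : borel_prob R).
Proof.
have mexp : measurable_fun [set: measurableTypeR R]
    (fun t : R => (expR (- s * t))%:E).
  by apply/measurable_EFinP; exact: measurableT_comp.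
rewrite /laplace /mgf integral_mkcond integral_edge_mixture; last 2 first.
- apply/(measurable_restrictT _ _).1; first exact: measurable_itv.
  by apply: measurable_funTS; under eq_fun do rewrite -mulNr.
- by move=> t; rewrite patchE; case: ifPn => // _; rewrite lee_fin expR_ge0.
rewrite integral_edge_mixture//.
apply: eq_bigr => k _; congr (_ * _); apply: eq_integral => b _.
rewrite patchE mem_set; last by rewrite /edge; case: b; rewrite /= in_itv/= ler0n.
by rewrite mulNr.
Qed.

(** Edge [k] contributes [x_k u^k + (1 - x_k) u^(k+1) = u^(k+1) + (1 - u) u^k x_k], up to the factor
    1/4. *)
Lemma mgf_edge_mixture s x : (forall k, (k < 4)%N -> (0 <= x k <= 1)%R) ->
  let u := expR s in
  mgf s (edge_mixture x : borel_prob R) =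
  (4^-1 * (u + u ^+ 2 + u ^+ 3 + u ^+ 4 +
    (1 - u) * (x 0 + u * x 1 + u ^+ 2 * x 2 + u ^+ 3 * x 3)))%:E.
Proof.
move=> x01 u; rewrite /mgf integral_edge_mixture01//; last first.
  by apply/measurable_EFinP; exact: measurableT_comp.
have E (k : nat) : expR (s * k%:R) = (u ^+ k)%R by rewrite mulrC -expRM_natl.
rewrite !big_ord_recr big_ord0/= !E add0e -!EFinM -!EFinD.
by congr EFin; ring.
Qed.

(** Used at the extreme atoms 0 and 4, which belong to one edge each: their masses [x_0 / 4] and
    [(1 - x_3) / 4] recover [x_0] and [x_3]. *)
Lemma edge_mixture_set1 x (n : nat) :
    (forall k, (k < 4)%N -> (0 <= x k <= 1)%R) ->
  edge_mixture x [set n%:R%R] =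
  (\sum_(k < 4) 4^-1 * (x k * (k == n :> nat)%:R +
                        (1 - x k) * (k.+1 == n)%:R))%R%:E.
Proof.
move=> x01; rewrite edge_mixtureE -sumEFin; apply: eq_bigr => k _.
have E b m : \d_b (edge m @^-1` [set n%:R%R]) =
    ((if b then m else m.+1) == n)%:R%:E :> \bar R.
  rewrite diracE; congr ((nat_of_bool _)%:R%:E); apply/idP/eqP => [/set_mem|mn].
    by rewrite /edge; case: b => /eqP; rewrite eqr_nat => /eqP.
  by apply/mem_set; move: mn; rewrite /edge; case: b => <-.
by rewrite bernoulli_probE ?x01// !E.
Qed.

End edge_mixture.

(** * The random parameters: two fair bits and two uniform variables *)

Section coin_toss.
Context {R : realType}.
Local Notation unif01 := (uniform_prob (@ltr01 R)).
Local Notation T := ((bool * bool) * (measurableTypeR R * measurableTypeR R))%type.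
Implicit Types (a b c d s : R) (g : R -> \bar R) (F G : T -> \bar R) (e : bool).

Definition coin : probability bool R := bernoulli_prob 2^-1.

Definition sample : probability T R := (coin \x coin) \x (unif01 \x unif01).

(** The uniform variables live on the whole line; this is the event of probability 1 on which they
    lie in [0, 1]. *)
Definition unit_square : set T := setT `*` (`[0%R, 1%R] `*` `[0%R, 1%R]).

Lemma measurable_unit_square : measurable unit_square.
Proof. by apply: measurableX => //; exact: measurableX. Qed.

Lemma unif01_itv : unif01 `[0%R, 1%R] = 1.
Proof. exact: integral_uniform_pdf1. Qed.

Lemma sample_unit_square : sample unit_square = 1.
Proof.
pose I : set (measurableTypeR R) := `[0%R, 1%R]%classic.
transitivity ((coin \x coin) setT * (unif01 \x unif01) (I `*` I)).
  by apply: product_measure1E => //; exact: measurableX.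
have -> : (unif01 \x unif01) (I `*` I) = unif01 I * unif01 I.
  by apply: product_measure1E; exact: measurable_itv.
by rewrite [X in X * _]probability_setT !unif01_itv !mule1.
Qed.

Lemma eq_integral_sample F G : measurable_fun setT F -> measurable_fun setT G ->
    (forall w, 0 <= F w) -> (forall w, 0 <= G w) ->
    (forall w, unit_square w -> F w = G w) ->
  \int[sample]_w F w = \int[sample]_w G w.
Proof.
move=> mF mG F0 G0 FG; apply: ge0_ae_eq_integral => //.
exists (~` unit_square); split; first exact: measurableC measurable_unit_square.
  apply: etrans (probability_setC sample measurable_unit_square) _.
  by rewrite sample_unit_square subee.
by move=> w /= nFG; apply: contra_not nFG => sw _; exact: FG.
Qed.

Lemma integral_sample F : measurable_fun setT F -> (forall w, 0 <= F w) ->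
  let I i j := \int[unif01]_u \int[unif01]_v F ((i, j), (u, v)) in
  \int[sample]_w F w =
  (4^-1)%:E * (I true true + I false false + (I true false + I false true)).
Proof.
move=> mF F0 I; rewrite fubini_tonelli1//.
have I0 i j : 0 <= I i j by apply: integral_ge0 => u _; exact: integral_ge0.
have half01 : (0 <= (2^-1 : R) <= 1)%R by lra.
transitivity (\int[coin \x coin]_z I z.1 z.2).
  apply: eq_integral => -[i j] _; rewrite /fubini_F fubini_tonelli1//.
  exact: measurable_fun_pair2.
have mI : measurable_fun setT (fun z : bool * bool => I z.1 z.2).
  (* A function of two bits is a nested conditional between constants, hence measurable. *)
  have -> : (fun z : bool * bool => I z.1 z.2) = fun z =>
      if z.1 then if z.2 then I true true else I true false
      else if z.2 then I false true else I false false.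
    by apply/funext => -[[] []].
  by apply: measurable_fun_ifT => //; apply: measurable_fun_ifT.
rewrite fubini_tonelli1//.
rewrite integral_bernoulli_prob//; last first.
  by move=> i; apply: integral_ge0 => j _; exact: I0.
rewrite /fubini_F !integral_bernoulli_prob//=.
move: (I) I0 => J J0.
have -> : unstable.onem (2^-1 : R) = (2^-1)%R by rewrite /unstable.onem; lra.
rewrite -!ge0_muleDr ?mule_ge0 ?adde_ge0// muleA -EFinM.
have -> : (2^-1 * 2^-1 = 4^-1 :> R)%R by lra.
by rewrite (addeC (J false true)) addeACA.
Qed.

(** The flag [e] selects one of the two laws: exchanging the cases [i = j] and [i != j] amounts to
    negating [e]. Coordinates beyond 3 are 0. *)
Definition toss e (w : T) (k : nat) : R :=
  let: (i, j, (u, v)) := w in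
  nth 0%R (if e == (i == j) then [:: i%:R; u; v; j%:R]
           else [:: u; i%:R; j%:R; v])%R k.

Lemma toss01 e w k : unit_square w -> (k < 4)%N -> (0 <= toss e w k <= 1)%R.
Proof.
case: w => [[i j] [u v]] [_ []] /=; rewrite !in_itv/= => u01 v01.
have b01 (b : bool) : (0 <= (b%:R : R) <= 1)%R by case: b; rewrite ?ler01 ?lexx.
have [i01 j01] := (b01 i, b01 j).
by case: (_ == _); move: k => [|[|[|[|]]]] //=.
Qed.

Lemma measurable_toss e k : measurable_fun setT (toss e ^~ k).
Proof.
have -> : toss e ^~ k = fun w =>
    if w.1.1 then
      if w.1.2 then toss e ((true, true), w.2) k
      else toss e ((true, false), w.2) k
    else
      if w.1.2 then toss e ((false, true), w.2) k
      else toss e ((false, false), w.2) k.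
  by apply/funext => -[[[] []] [u v]].
have m1 : measurable_fun setT (fun w : T => w.1.1).
  exact: measurableT_comp.
have m2 : measurable_fun setT (fun w : T => w.1.2).
  exact: measurableT_comp.
have mu : measurable_fun setT (fun w : T => w.2.1).
  exact: measurableT_comp.
have mv : measurable_fun setT (fun w : T => w.2.2).
  exact: measurableT_comp.
(* Once the bits are fixed, every coordinate is a constant or a projection. *)
have mt i j : measurable_fun setT (fun w : T => toss e ((i, j), w.2) k).
  have -> : (fun w : T => toss e ((i, j), w.2) k) =
    fun w => nth 0%R (if e == (i == j) then [:: i%:R; w.2.1; w.2.2; j%:R]
           else [:: w.2.1; i%:R; j%:R; w.2.2])%R k.
    by apply/funext => -[? []].
  by case: (_ == _); move: k => [|[|[|[|k]]]] //=; rewrite nth_nil.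
by apply: measurable_fun_ifT => //; apply: measurable_fun_ifT.
Qed.

(** * The two random measures and the laws of their transforms *)

Definition toss_mixture e (w : T) : borel_prob R := edge_mixture (toss e w).

Lemma measurable_toss_mixture e : measurable_fun setT (toss_mixture e).
Proof. by apply: measurable_edge_mixture => k; exact: measurable_toss. Qed.

HB.instance Definition _ e := isMeasurableFun.Build _ _ _ _ (toss_mixture e)
  (@measurable_toss_mixture e).

(** The right-hand side does not involve [e]: the linear form has the same law in both cases.
    Summing over the bits gives one side of [average_swap] for each value of [e]. *)
Lemma integral_toss_form e a b c d g :
    (0 < a)%R -> (0 < b)%R -> (0 < c)%R -> (0 < d)%R ->
    (a * d = b * c)%R -> measurable_fun setT g -> (forall x, 0 <= g x <= 1) ->
  \int[sample]_w g (a * toss e w 0 + b * toss e w 1 +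
                    c * toss e w 2 + d * toss e w 3)%R =
  (4^-1)%:E *
    (average b (average c g) 0%R + average b (average c g) (a + d)%R +
     (average a (average d g) b + average a (average d g) c)).
Proof.
move=> a0 b0 c0 d0 adbc mg g01.
have g0 x : 0 <= g x by case/andP: (g01 x).
pose L e' w := (a * toss e' w 0 + b * toss e' w 1 +
                c * toss e' w 2 + d * toss e' w 3)%R.
have mL e' : measurable_fun setT (fun w => g (L e' w)).
  apply: (measurableT_comp mg).
  do 3 (apply: measurable_funD;
    last by apply: measurable_funM => //; exact: measurable_toss).
  by apply: measurable_funM => //; exact: measurable_toss.
have I e' (i j : bool) :
    \int[unif01]_u \int[unif01]_v g (L e' ((i, j), (u, v))) =
    if e' == (i == j) then average b (average c g) (a * i%:R + d * j%:R)%R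
    else average a (average d g) (b * i%:R + c * j%:R)%R.
  have bc (p u v q : R) :
    (a * p + b * u + c * v + d * q = a * p + d * q + b * u + c * v)%R by ring.
  have ad (u p q v : R) :
    (a * u + b * p + c * q + d * v = b * p + c * q + a * u + d * v)%R by ring.
  rewrite !average_average /L /toss; case: (e' == _) => /=.
    by do 2 (apply: eq_integral => ? _); congr g; exact: bc.
  by do 2 (apply: eq_integral => ? _); congr g; exact: ad.
apply: etrans (integral_sample (mL e) (fun w => g0 (L e w))) _; cbv zeta beta.
rewrite (I e true true) (I e false false) (I e true false) (I e false true).
have := average_swap a0 b0 c0 d0 adbc mg g01.
move: (average b (average c g)) (average a (average d g)) => B A swap.
case: e => /=; rewrite !mulr1 !mulr0 !addr0 !add0r.
  by rewrite (addeC (B (a + d)%R)).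
by rewrite swap (addeC (A (b + c)%R)); congr (_ * _); exact: addeC.
Qed.

(** The coefficients 1, [u], [u^2], [u^3] satisfy [1 * u^3 = u * u^2], so [integral_toss_form]
    applies to the indicator of [A] composed with the affine map [h]. *)
Lemma mgf_toss_mixture s : same_distribution sample
  (mgf_rv sample (toss_mixture true) s) (mgf_rv sample (toss_mixture false) s).
Proof.
move=> A mA; pose u := expR s.
pose h (t : R) : \bar R := (4^-1 * (u + u ^+ 2 + u ^+ 3 + u ^+ 4 + (1 - u) * t))%:E.
pose g (t : R) : \bar R := (\1_A (h t))%:E.
have mg : measurable_fun setT g.
  have mi : measurable_fun setT (\1_A : \bar R -> R).
    exact: measurable_indic.
  apply/measurable_EFinP; apply: (measurableT_comp mi).
  apply/measurable_EFinP; apply: measurable_funM => //.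
  by apply: measurable_funD => //; exact: measurable_funM.
have g01 t : 0 <= g t <= 1 by rewrite !lee_fin indicE ler0n lern1 leq_b1.
pose L e w := (1 * toss e w 0 + u * toss e w 1 +
               u ^+ 2 * toss e w 2 + u ^+ 3 * toss e w 3)%R.
have mL e : measurable_fun setT (fun w => g (L e w)).
  apply: (measurableT_comp mg).
  do 3 (apply: measurable_funD;
    last by apply: measurable_funM => //; exact: measurable_toss).
  by apply: measurable_funM => //; exact: measurable_toss.
have key e : distribution sample (mgf_rv sample (toss_mixture e) s) A =
    \int[sample]_w g (L e w).
  have mE : measurable (mgf_rv sample (toss_mixture e) s @^-1` A).
    by rewrite -[X in measurable X]setTI; exact: measurable_funPT.
  rewrite -[LHS]/(sample (mgf_rv sample (toss_mixture e) s @^-1` A)).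
  rewrite -[X in sample X]setIT -integral_indic//.
  (* On the unit square the parameters lie in [0, 1], as the closed form of the transform
     requires. *)
  apply: eq_integral_sample => //.
  - by apply/measurable_EFinP; exact: measurable_indic.
  - by move=> w; case/andP: (g01 (L e w)).
  move=> w sw; rewrite /g -[LHS]/(\1_A (mgf s (toss_mixture e w)))%:E.
  rewrite /toss_mixture mgf_edge_mixture; last by move=> k; exact: toss01.
  by rewrite /h /L mul1r.
have u0 : (0 < u)%R by exact: expR_gt0.
by rewrite !key /L !integral_toss_form ?exprn_gt0//; rewrite mul1r -exprS.
Qed.

Lemma laplace_toss_mixture s : same_distribution sample
  (laplace_rv sample (toss_mixture true) s)
  (laplace_rv sample (toss_mixture false) s).
Proof.
move=> A mA.
have laplaceE e : distribution sample (laplace_rv sample (toss_mixture e) s) A =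
    distribution sample (mgf_rv sample (toss_mixture e) (- s)) A.
  have mgfE : laplace s \o toss_mixture e = mgf (- s) \o toss_mixture e.
    by apply/funext => w; exact: laplace_edge_mixture.
  rewrite -[LHS]/(sample ((laplace s \o toss_mixture e) @^-1` A)).
  rewrite -[RHS]/(sample ((mgf (- s) \o toss_mixture e) @^-1` A)).
  by rewrite mgfE.
by rewrite !laplaceE; exact: mgf_toss_mixture.
Qed.

(** * An event that separates the two laws *)

Lemma toss_mixture_neq : ~ same_distribution sample
  (toss_mixture true) (toss_mixture false).
Proof.
(* The event [x_0 >= 1 /\ x_3 >= 1], seen through the masses of the atoms 0 and
   4, has probability [1/4 + q/2] under one law and [q/2] under the other, where
   [q] is the probability that [U >= 1] and [V >= 1]; only [q < +oo] matters. *)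
pose B := [set m : borel_prob R | (4^-1)%:E <= m [set 0%:R%R]] `&`
          [set m : borel_prob R | m [set 4%:R%R] <= 0].
have mB : measurable B.
  apply: measurableI; rewrite -[X in measurable X]setTI.
    by apply: emeasurable_fun_c_infty => //; exact: measurable_eval.
  by apply: emeasurable_fun_infty_c => //; exact: measurable_eval.
pose f (p q : R) : \bar R := ((1 <= p)%R && (1 <= q)%R)%:R%:E.
pose F e w := f (toss e w 0) (toss e w 3).
have F0 e w : 0 <= F e w by rewrite lee_fin ler0n.
have mF e : measurable_fun setT (F e).
  apply/measurable_EFinP.
  rewrite (_ : (fun _ => _) = (fun w =>
      if (1 <= toss e w 0)%R && (1 <= toss e w 3)%R then 1%R else 0%R)).
    apply: measurable_fun_ifT => //; apply: measurable_and;
      apply: measurable_fun_ler => //; exact: measurable_toss.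
  by apply/funext => w; case: (_ && _).
have key e : distribution sample (toss_mixture e) B = \int[sample]_w F e w.
  have mE : measurable (toss_mixture e @^-1` B).
    by rewrite -[X in measurable X]setTI; exact: measurable_funPT.
  rewrite -[LHS]/(sample (toss_mixture e @^-1` B)).
  rewrite -[X in sample X]setIT -integral_indic//.
  apply: eq_integral_sample => //.
    by apply/measurable_EFinP; exact: measurable_indic.
  move=> w sw; rewrite /F /f indicE; congr ((nat_of_bool _)%:R%:E).
  have t01 k : (k < 4)%N -> (0 <= toss e w k <= 1)%R by exact: toss01.
  have -> : (w \in toss_mixture e @^-1` B) =
      ((4^-1)%:E <= edge_mixture (toss e w) [set 0%:R%R]) &&
      (edge_mixture (toss e w) [set 4%:R%R] <= 0).
    apply/idP/andP; first by move/set_mem.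
    by move=> H; apply/mem_set.
  rewrite !edge_mixture_set1// !big_ord_recr !big_ord0/= !lee_fin.
  by congr (_ && _); apply/idP/idP; lra.
have [q qE] : exists q, q = \int[unif01]_u \int[unif01]_v f u v by eexists.
have q0 : 0 <= q.
  rewrite qE; apply: integral_ge0 => u _; apply: integral_ge0 => v _.
  by rewrite lee_fin.
have cst01 (r : \bar R) : \int[unif01]_u r = r.
  rewrite (integral_cst _ measurableT) [X in _ * X](@probability_setT _ _ _ unif01).
  exact: mule1.
have ge1 (i : bool) : (1 <= i%:R :> R)%R = i by case: i; rewrite ?lexx// ler10.
have J e i j : \int[unif01]_u \int[unif01]_v F e ((i, j), (u, v)) =
    if e == (i == j) then (i && j)%:R%:E else q.
  rewrite qE /F /toss; case: (e == _) => /=.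
    rewrite /f !ge1.
    by under eq_integral do rewrite cst01; rewrite cst01.
  by [].
have intF e : \int[sample]_w F e w =
    (4^-1)%:E * if e then 1 + 0 + (q + q) else q + q + (0 + 0).
  apply: etrans (integral_sample (mF e) (F0 e)) _; cbv zeta beta.
  by rewrite !J; case: e.
(* This excludes [q = +oo], for which both probabilities would read [+oo] and could not be told
   apart. *)
have le1 : (4^-1)%:E * (q + q) <= 1.
  have : distribution sample (toss_mixture false) B <= 1.
    exact: (probability_le1 (distribution sample (toss_mixture false)) mB).
  by rewrite key intF !adde0.
move=> /(_ B mB); rewrite !key !intF !adde0.
move: q q0 le1 {qE J intF} => [q| |] //= _.
  by rewrite -!EFinD -!EFinM => _ [] H; lra.
by rewrite !addye// mulry gtr0_sg// mul1e leye_eq.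
Qed.

End coin_toss.

Local Close Scope ereal_scope.

Theorem theorem4p0p4 (R : realType) :
  exists (d : measure_display) (Omega : measurableType d)
    (P : probability Omega R) (mu nu : random_prob_measure P),
    [/\ uniformly_bounded P mu /\ uniformly_bounded P nu,
        as_in_Pplus P mu /\ as_in_Pplus P nu,
        ~ same_distribution P mu nu,
        forall s : R, 0 <= s ->
          same_distribution P (laplace_rv P mu s) (laplace_rv P nu s)
      & forall s : R, same_distribution P (mgf_rv P mu s) (mgf_rv P nu s)].
Proof.
exists _, _, (@sample R), (@toss_mixture R true), (@toss_mixture R false).
split.
(* The support conditions hold at every outcome, as the atoms always lie in {0, ..., 4}. *)
- have le4 k : (k <= 4)%N -> `[- 4, 4 : R]%classic k%:R.
    by move=> k4; rewrite /= in_itv/= ler_nat k4 (le_trans _ (ler0n _ _))// oppr_le0.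
  by split; exists 4 => //; apply: aeW => w; exact: edge_mixture1.
- by split; apply: aeW => w; apply: edge_mixture1 => k _; rewrite /= in_itv/= ler0n.
- exact: toss_mixture_neq.
- by move=> s _; exact: laplace_toss_mixture.
- exact: mgf_toss_mixture.
Qed.
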